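(* Let $n\ge 2$, let $z_1,\ldots,z_n,w_1,\ldots,w_{n-1}\in\mathbf{C}$, and let $p(z)=\prod_{i=1}^n(z-z_i)$ and $q(z)=n\prod_{j=1}^{n-1}(z-w_j)$. For $\alpha\in\mathbf{C}$ and $1\le k\le n-1$ define the unordered $\binom{n}{k}$-tuple and $\binom{n-1}{k}$-tuple of complex numbers $$Z(\alpha,k)=\Bigl(\prod_{j=1}^k(z_{i_j}-\alpha)\Bigr)_{1\le i_1<\cdots<i_k\le n},\qquad W(\alpha,k)=\Bigl(\prod_{j=1}^k(w_{i_j}-\alpha)\Bigr)_{1\le i_1<\cdots<i_k\le n-1}.$$ Then the following conditions are equivalent: (i) $q(z)=p'(z)$ for any $z\in\mathbf{C}$. (ii) For any $\alpha\in\mathbf{C}$ and $1\le k\le n-1$ one has $W(\alpha,k)\prec Z(\alpha,k)$. (iii) For $1\le k\le n-1$ one has $W(0,k)\prec Z(0,k)$. (iv) For any convex function $f:\mathbf{C}\to\mathbf{R}$, any $\alpha\in\mathbf{C}$ and $1\le k\le n-1$ one has $$\frac{1}{\binom{n-1}{k}}\sum_{1\le i_1<\cdots<i_k\le n-1}f\Bigl(\prod_{j=1}^k(w_{i_j}-\alpha)\Bigr)\le\frac{1}{\binom{n}{k}}\sum_{1\le i_1<\cdots<i_k\le n}f\Bigl(\prod_{j=1}^k(z_{i_j}-\alpha)\Bigr).$$ (v) The inequalities in (iv) hold for $\alpha=0$ (for any convex function $f:\mathbf{C}\to\mathbf{R}$ and $1\le k\le n-1$).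
   Context: An $m\times n$ real matrix $R=(r_{ij})$ with $m\le n$ is called rectangularly stochastic if $r_{ij}\ge0$, $\sum_{j=1}^nr_{ij}=1$ and $\sum_{i=1}^mr_{ij}=\frac mn$ for $1\le i\le m$, $1\le j\le n$. Let $X=(x_1,\ldots,x_m)^t$ and $Y=(y_1,\ldots,y_n)^t$ be an unordered $m$-tuple and an unordered $n$-tuple of vectors in $\mathbf{R}^k$, with $n\ge m$, $k\ge1$; after choosing orderings these are identified with an $m\times k$ matrix $\tilde X$ and an $n\times k$ matrix $\tilde Y$ (rows are the vectors). One says $X$ is majorized by $Y$, written $X\prec Y$, if there exists a rectangularly stochastic $m\times n$ matrix $R$ with $\tilde X=R\tilde Y$ for some (equivalently any) orderings; by a theorem of Sherman this is equivalent to $\frac1m\sum_{i=1}^mf(x_i)\le\frac1n\sum_{i=1}^nf(y_i)$ for every convex function $f:\mathbf{R}^k\to\mathbf{R}$. For tuples of complex numbers, $\prec$ and convexity are understood by identifying $\mathbf{C}$ with $\mathbf{R}^2$. *)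

(* Defs.v *)
From mathcomp Require Import all_boot all_order all_algebra.
From mathcomp Require Import complex.
From mathcomp Require Import classical_sets reals convex.

Set Implicit Arguments.
Unset Strict Implicit.
Unset Printing Implicit Defensive.

Import Order.TTheory GRing.Theory Num.Theory.

Local Open Scope ring_scope.

Definition rectangularly_stochastic (R : realType) (m n : nat)
    (P : 'M[R]_(m, n)) : Prop :=
  [/\ (m <= n)%N,
      forall i j, 0 <= P i j,
      forall i, \sum_(j < n) P i j = 1 &
      forall j, \sum_(i < m) P i j = m%:R / n%:R].

Definition mx_of_seq (R : realType) (d : nat) (s : seq 'rV[R]_d) :
    'M[R]_(size s, d) :=
  \matrix_(i < size s) s`_i.

(* An unordered tuple is a sequence taken up to [perm_eq]; [s] and [t] are the
   chosen orderings of [X] and [Y]. *)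
Definition majorized (R : realType) (d : nat) (X Y : seq 'rV[R]_d) : Prop :=
  exists s t : seq 'rV[R]_d,
    [/\ perm_eq s X, perm_eq t Y &
        exists P : 'M[R]_(size s, size t),
          rectangularly_stochastic P /\ mx_of_seq s = P *m mx_of_seq t].

Definition rv_of_complex (R : realType) (x : R[i]) : 'rV[R]_2 :=
  \row_(j < 2) (if j == 0 then complex.Re x else complex.Im x).

Definition cmajorized (R : realType) (X Y : seq R[i]) : Prop :=
  majorized (map (@rv_of_complex R) X) (map (@rv_of_complex R) Y).

(* Strictly increasing k-tuples of indices are the k-element subsets of 'I_n;
   each subset contributes one entry, so repeated values are kept. *)
Definition shifted_products (R : realType) (n : nat) (z : 'I_n -> R[i])
    (alpha : R[i]) (k : nat) : seq R[i] :=
  [seq \prod_(i in A) (z i - alpha)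
    | A : {set 'I_n} in [set B : {set 'I_n} | #|B| == k]].

(* [Rcomplex R] is [R[i]] seen as a real vector space, i.e. as R^2. *)
Definition cconvex (R : realType) (f : R[i] -> R) : Prop :=
  convex_function (E := Rcomplex R) [set: Rcomplex R]%classic f.

Definition mean_ineq (R : realType) (n : nat)
    (z : 'I_n -> R[i]) (w : 'I_n.-1 -> R[i])
    (f : R[i] -> R) (alpha : R[i]) (k : nat) : Prop :=
  'C(n.-1, k)%:R^-1 *
      (\sum_(A : {set 'I_n.-1} | #|A| == k) f (\prod_(j in A) (w j - alpha)))
  <= 'C(n, k)%:R^-1 *
      (\sum_(A : {set 'I_n} | #|A| == k) f (\prod_(j in A) (z j - alpha))).

(* Main.v *)
(* The idea is to realise the critical points as eigenvalues of a compression.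
   Let [D] be the diagonal matrix of the [z i]. By Schur there is an
   orthonormal basis [U] of the orthogonal complement of [(1, ..., 1)] in which
   the compression [U D U^*] is triangular, with diagonal [t]. Cauchy-Binet
   applied to the principal minors of [U (D - alpha) U^*] writes each product of
   [k] of the [t j - alpha] as a combination of the products of [k] of the
   [z i - alpha], with weights the squared moduli of the [k]-minors of [U]. The
   rows of weights sum to 1 as [U U^* = 1], and the columns to [1 - k/n] as
   [U^* U = 1 - J/n] with [J] the all-ones matrix; so [t] satisfies (ii).

   Conversely (v) for [f = +-Re, +-Im] fixes the elementary symmetric functions
   of [w], and these are the coefficients of [p']. Applied to [t], this shows
   that [t] lists the roots of [p']; hence (i) forces [w] to be a permutation of
   [t], and [w] inherits (ii). *)
Require Import Defs.
From HB Require Import structures.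
From mathcomp Require Import all_boot all_order all_algebra.
From mathcomp Require Import fingroup perm.
From mathcomp Require Import complex.
From mathcomp Require Import classical_sets reals convex.
From mathcomp Require Import interval_inference.
From mathcomp Require Import ring.

Set Implicit Arguments.
Unset Strict Implicit.
Unset Printing Implicit Defensive.

Import Order.TTheory GRing.Theory Num.Theory.

Local Open Scope ring_scope.

(** * Determinants: Cauchy-Binet and principal minors *)

(** Two block triangular factorisations of [block_mx 1%:M B A 1%:M]. It serves to reduce a minor of
    the identity minus a rank-one matrix to a 1 x 1 determinant. *)
Lemma det_1Bmulmx (R : comNzRingType) (m n : nat)
    (A : 'M[R]_(m, n)) (B : 'M[R]_(n, m)) :
  \det (1%:M - A *m B) = \det (1%:M - B *m A).
Proof.
have E : block_mx 1%:M 0 A 1%:M *m block_mx 1%:M B 0 (1%:M - A *m B)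
       = block_mx (1%:M - B *m A) B 0 1%:M *m block_mx 1%:M 0 A 1%:M.
  rewrite !mulmx_block !mul1mx !mulmx1 !mul0mx !mulmx0 !addr0 !add0r.
  by rewrite subrK addrC subrK.
move/(congr1 determinant): E; rewrite !det_mulmx !det_lblock !det_ublock.
by rewrite !det1 !mul1r !mulr1.
Qed.

(** Multilinearity: each row of [A *m B] is a combination of the rows of [B], and [f] records which
    row of [B] is picked. *)
Lemma det_mulmx_ffun (R : comNzRingType) (k n : nat)
    (A : 'M[R]_(k, n)) (B : 'M[R]_(n, k)) :
  \det (A *m B) =
  \sum_(f : {ffun 'I_k -> 'I_n}) (\prod_i A i (f i)) * \det (rowsub f B).
Proof.
rewrite {1}/determinant; under eq_bigr => s _.
  under eq_bigr do rewrite mxE.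
  rewrite bigA_distr_bigA mulr_sumr /=; over.
rewrite exchange_big /=; apply: eq_bigr => f _.
rewrite /determinant mulr_sumr; apply: eq_bigr => s _.
rewrite big_split /= mulrCA; congr (_ * (_ * _)).
by apply: eq_bigr => i _; rewrite mxE.
Qed.

(* Cauchy-Binet with every [k]-subset counted [k!] times, which spares a choice
   of ordering for each subset. *)
Lemma sum_det_colsub_rowsub (R : comNzRingType) (k n : nat)
    (A : 'M[R]_(k, n)) (B : 'M[R]_(n, k)) :
  \sum_(f : {ffun 'I_k -> 'I_n}) \det (colsub f A) * \det (rowsub f B)
  = k`!%:R * \det (A *m B).
Proof.
under eq_bigr => f _ do rewrite /(\det (colsub f A)) mulr_suml.
rewrite exchange_big /=.
transitivity (\sum_(s : 'S_k) \det (A *m B)); last first.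
  by rewrite sumr_const card_Sn mulr_natl.
apply: eq_bigr => s _; rewrite det_mulmx_ffun.
(* Reindexing by [h] undoes [s] in the product of entries of [A] and permutes the rows of the minor
   of [B]; the resulting sign cancels that of the Leibniz term. *)
pose h (f : {ffun 'I_k -> 'I_n}) : {ffun 'I_k -> 'I_n} :=
  [ffun i => f ((s^-1)%g i)].
rewrite (reindex h) /=; last first.
  exists (fun f : {ffun 'I_k -> 'I_n} => [ffun i => f (s i)]) => f _;
  by apply/ffunP => i; rewrite !ffunE ?permK ?permKV.
apply: eq_bigr => f _.
have -> : rowsub (h f) B = row_perm s^-1%g (rowsub f B).
  by apply/matrixP => i j; rewrite !mxE ffunE.
rewrite row_permE det_mulmx det_perm odd_permV mulrACA.
rewrite -signr_addb addbb mul1r; congr (_ * _).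
by apply: eq_bigr => i _; rewrite mxE ffunE permK.
Qed.

Lemma det_mxsub_mul_diag (R : comNzRingType) (k m n : nat) (A : 'M[R]_(m, n))
    (B : 'M[R]_(n, m)) (d : 'rV[R]_n) (g : 'I_k -> 'I_m) :
  k`!%:R * \det (mxsub g g (A *m diag_mx d *m B)) =
  \sum_(f : {ffun 'I_k -> 'I_n})
    \det (mxsub g f A) * \det (mxsub f g B) * \prod_i d 0 (f i).
Proof.
rewrite mxsub_mul -sum_det_colsub_rowsub; apply: eq_bigr => f _.
have -> : colsub f (rowsub g (A *m diag_mx d)) =
          mxsub g f A *m diag_mx (\row_i d 0 (f i)).
  by apply/matrixP => i j; rewrite !mul_mx_diag !mxE.
rewrite det_mulmx det_diag mulrAC; congr (_ * \det _ * _).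
  by apply/matrixP => i j; rewrite !mxE.
by apply: eq_bigr => i _; rewrite mxE.
Qed.

(** As [g] need not be monotone, the submatrix need not be triangular; still, every permutation
    other than the identity meets an entry of [T] above the diagonal. *)
Lemma det_mxsub_trig (R : comNzRingType) (k m : nat) (T : 'M[R]_m)
    (g : 'I_k -> 'I_m) :
  injective g -> is_trig_mx T -> \det (mxsub g g T) = \prod_i T (g i) (g i).
Proof.
move=> g_inj /is_trig_mxP T0; rewrite /determinant (bigD1 1%g) //=.
rewrite [X in _ + X]big1 => [|s s1].
  rewrite odd_perm1 mul1r addr0; apply: eq_bigr => i _.
  by rewrite !mxE perm1.
suff [i lt_i] : exists i, (g i < g (s i))%N.
  by rewrite (bigD1 i) //= mxE T0 // mul0r mulr0.
apply/existsP; apply: contraNT s1 => /existsPn s_le.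
(* The values [g (s i)] and [g i] have the same sum, so these inequalities are all equalities, and
   injectivity of [g] makes [s] the identity. *)
have le_i i : (g (s i) <= g i ?= iff (g (s i) == g i))%N.
  by split; rewrite ?val_eqE // leqNgt s_le.
have [_] := leqif_sum (fun i (_ : true) => le_i i).
rewrite [X in _ == X](reindex_inj (@perm_inj _ s)) /= eqxx => /esym/forallP H.
by apply/eqP/permP => i; rewrite perm1; apply/g_inj/eqP/H.
Qed.

(** * Orderings of subsets and squared minors *)

Definition ffun_onto (T : finType) (k : nat) (A : {set T})
    (f : {ffun 'I_k -> T}) : bool :=
  injectiveb f && (f @: 'I_k == A).

Lemma card_ffun_onto (T : finType) (k : nat) (A : {set T}) :
  #|A| = k -> #|[set f | @ffun_onto T k A f]| = k`!.
Proof.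
move=> Ak; transitivity (#|A| ^_ #|'I_k|); last by rewrite Ak card_ord ffactnn.
rewrite -card_inj_ffuns_on; apply: eq_card => f.
rewrite [LHS]inE [RHS]inE /ffun_onto andbC.
apply: andb_id2r => /injectiveP f_inj.
rewrite eqEcard card_imset // card_ord Ak leqnn andbT.
apply/idP/ffun_onP => [/fintype.subsetP fA i | fA].
  by rewrite fA ?imset_f.
by apply/fintype.subsetP => _ /imsetP[i _ ->].
Qed.

Lemma sum_ffun_onto (R : nmodType) (T : finType) (k : nat)
    (F : {ffun 'I_k -> T} -> R) :
  (forall f : {ffun 'I_k -> T}, ~~ injectiveb f -> F f = 0) ->
  \sum_f F f = \sum_(A : {set T} | #|A| == k) \sum_(f | ffun_onto A f) F f.
Proof.
move=> F0; rewrite (bigID (fun f : {ffun _ -> _} => injectiveb f)) /=.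
rewrite [X in _ + X]big1 // addr0.
apply: (partition_big (fun f : {ffun 'I_k -> T} => f @: 'I_k)) => f.
by move=> /injectiveP f_inj; rewrite card_imset // card_ord.
Qed.

Lemma prod_ffun_onto (R : comNzRingType) (T : finType) (k : nat) (A : {set T})
    (f : {ffun 'I_k -> T}) (F : T -> R) :
  ffun_onto A f -> \prod_i F (f i) = \prod_(x in A) F x.
Proof.
case/andP => /injectiveP f_inj /eqP <-.
by rewrite big_imset //= => x y _ _ /f_inj.
Qed.

Lemma sum_ffun_onto_const (R : pzRingType) (T : finType) (k : nat)
    (A : {set T}) (F : {ffun 'I_k -> T} -> R) (c : R) :
  #|A| = k -> (forall f, ffun_onto A f -> F f = c) ->
  \sum_(f | ffun_onto A f) F f = k`!%:R * c.
Proof.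
move=> Ak Fc; rewrite (eq_bigr (fun=> c)) // sumr_const mulr_natl.
by rewrite -(card_ffun_onto Ak) cardsE.
Qed.

Lemma det_mxsub_noninj (R : comNzRingType) (k m n : nat) (A : 'M[R]_(m, n))
    (g : 'I_k -> 'I_m) (f : {ffun 'I_k -> 'I_n}) :
  ~~ injectiveb f -> \det (mxsub g f A) = 0.
Proof.
case/injectivePn => i [j nij fij]; rewrite -det_tr.
by apply: (determinant_alternate nij) => a; rewrite !mxE fij.
Qed.

(* [sqminor U k S K] is the squared modulus of the minor of [U] with rows [S]
   and columns [K], written as an average over all orderings. *)
Definition sqminor (C : numClosedFieldType) (m n : nat) (U : 'M[C]_(m, n))
    (k : nat) (S : {set 'I_m}) (K : {set 'I_n}) : C :=
  k`!%:R ^- 2 * \sum_(g : {ffun 'I_k -> 'I_m} | ffun_onto S g)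
    \sum_(f : {ffun 'I_k -> 'I_n} | ffun_onto K f) `|\det (mxsub g f U)| ^+ 2.

Section SqMinor.
Local Open Scope sesquilinear_scope.
Context (C : numClosedFieldType) (m n : nat) (U : 'M[C]_(m, n)) (k : nat).

Lemma sqminor_ge0 (S : {set 'I_m}) (K : {set 'I_n}) : 0 <= sqminor U k S K.
Proof.
rewrite /sqminor mulr_ge0 ?invr_ge0 ?exprn_ge0 ?ler0n //.
by do 2![apply: sumr_ge0 => ? _]; rewrite exprn_ge0.
Qed.

Let fact_neq0 : k`!%:R != 0 :> C.
Proof. by rewrite pnatr_eq0 -lt0n fact_gt0. Qed.

Let sqnorm_det (g : 'I_k -> 'I_m) (f : 'I_k -> 'I_n) :
  `|\det (mxsub g f U)| ^+ 2 = \det (mxsub g f U) * \det (mxsub f g (U^t*)).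
Proof.
rewrite normCK; congr (_ * _); rewrite -det_map_mx -det_tr; congr (\det _).
by apply/matrixP => i j; rewrite !mxE.
Qed.

(** The right-hand side is the principal minor of a triangular matrix, which Cauchy-Binet expands
    over column sets. One [k!] comes from the orderings of [S], the other from Cauchy-Binet; both
    cancel the normalisation. *)
Lemma sum_sqminor_prod (d : 'rV[C]_n) (S : {set 'I_m}) :
  is_trig_mx (U *m diag_mx d *m U^t*) -> #|S| = k ->
  \sum_(K : {set 'I_n} | #|K| == k) sqminor U k S K * \prod_(i in K) d 0 i =
  \prod_(j in S) (U *m diag_mx d *m U^t*) j j.
Proof.
set T := _ *m _ => T_trig Sk.
rewrite /sqminor; under [LHS]eq_bigr => K _ do rewrite -mulrA mulr_suml.
rewrite -mulr_sumr exchange_big /=.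
rewrite (@sum_ffun_onto_const _ _ _ _ _ (k`!%:R * \prod_(j in S) T j j)) //.
  by rewrite expr2 invfM -mulrA !mulKf.
move=> g gS.
pose F (f : {ffun 'I_k -> 'I_n}) :=
  \det (mxsub g f U) * \det (mxsub f g (U^t*)) * \prod_i d 0 (f i).
transitivity (\sum_f F f).
  rewrite sum_ffun_onto => [|f f_ninj]; last first.
    by rewrite /F det_mxsub_noninj // !mul0r.
  apply: eq_bigr => K _; rewrite mulr_suml; apply: eq_bigr => f fK.
  by rewrite sqnorm_det /F (prod_ffun_onto (fun i => d 0 i) fK).
rewrite -det_mxsub_mul_diag det_mxsub_trig //; last first.
  by case/andP: gS => /injectiveP.
by rewrite (prod_ffun_onto (fun j => T j j) gS).
Qed.

(** The same expansion with the roles exchanged: the principal minor of [U^t* *m U] on [K] is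
    expanded over row sets. *)
Lemma sum_sqminor_col (K : {set 'I_n}) (c : C) :
  (forall f : {ffun 'I_k -> 'I_n}, ffun_onto K f ->
     \det (mxsub f f (U^t* *m U)) = c) ->
  #|K| = k ->
  \sum_(S : {set 'I_m} | #|S| == k) sqminor U k S K = c.
Proof.
move=> detc Kk; rewrite /sqminor -mulr_sumr.
under eq_bigr do rewrite exchange_big.
rewrite exchange_big /= (@sum_ffun_onto_const _ _ _ _ _ (k`!%:R * c)) //.
  by rewrite expr2 invfM -mulrA !mulKf.
move=> f fK; rewrite -sum_ffun_onto; last first.
  move=> g gninj.
  by rewrite -det_tr trmx_mxsub det_mxsub_noninj // normr0 expr0n.
(* The identity is inserted as a diagonal matrix so that the expansion with diagonal weights
   applies. *)
rewrite -(detc f fK) -[U^t*]mulmx1 -diag_const_mx det_mxsub_mul_diag.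
apply: eq_bigr => g _; rewrite sqnorm_det mulrC.
by rewrite [\prod_i _]big1 ?mulr1 // => i _; rewrite mxE.
Qed.

End SqMinor.

(** * Compression to the orthogonal complement of the all-ones vector *)

Section Compression.
Local Open Scope sesquilinear_scope.

(** [e] is the unit vector along (1, ..., 1), [V] an orthonormal basis of its complement, and [P] a
    Schur basis for the compression [V D V^*]; then [U] is [P *m V]. *)
Lemma exists_unitary_trig_compression (C : numClosedFieldType) (n : nat)
    (d : 'rV[C]_n.+1) : (0 < n)%N ->
  exists U : 'M[C]_(n, n.+1),
    [/\ U *m U^t* = 1%:M,
        U^t* *m U = 1%:M - n.+1%:R^-1 *: const_mx 1 &
        is_trig_mx (U *m diag_mx d *m U^t*)].
Proof.
move=> n_gt0.
pose e : 'rV[C]_n.+1 := (sqrtC n.+1%:R)^-1 *: const_mx 1.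
have cc : (sqrtC n.+1%:R)^-1 * ((sqrtC n.+1%:R)^-1)^* = n.+1%:R^-1 :> C.
  rewrite geC0_conj ?invr_ge0 ?sqrtC_ge0 ?ler0n // -invfM -expr2 sqrtCK //.
have ee : e *m e^t* = 1%:M.
  apply/matrixP => i j; rewrite !ord1 !mxE eqxx.
  under eq_bigr do rewrite !mxE !mulr1 cc.
  by rewrite sumr_const card_ord -[LHS]mulr_natl mulfV // pnatr_eq0.
have e_ee : e^t* *m e = n.+1%:R^-1 *: const_mx 1.
  apply/matrixP => i j; rewrite !mxE big_ord1 !mxE !mulr1 mulrC cc //.
have [V [VV Ve]] :
    exists V : 'M[C]_(n, n.+1), V *m V^t* = 1%:M /\ V *m e^t* = 0.
  pose B := kermx (e^t*).
  have rB : \rank B = n.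
    rewrite mxrank_ker mxrank_map mxrank_tr (mxrank_unitary (M := e)) ?subn1 //.
    exact/unitarymxP.
  (* The number of rows is first [\rank B], and is turned into [n] only once [V] exists. *)
  suff [V H] :
      exists V : 'M[C]_(\rank B, n.+1), V *m V^t* = 1%:M /\ V *m e^t* = 0.
    by move: V H; rewrite rB => V H; exists V.
  exists (schmidt (row_base B)); split.
    by apply/unitarymxP/schmidt_unitarymx; rewrite rank_leq_col.
  by apply/sub_kermxP; rewrite eqmx_schmidt_free ?row_base_free // eq_row_base.
have [P /unitarymxP PP Ptrig] := Schur (V *m diag_mx d *m V^t*) n_gt0.
have PP' : P^t* *m P = 1%:M := mulmx1C PP.
exists (P *m V); split.
- by rewrite trmx_mul map_mxM mulmxA -(mulmxA P) VV mulmx1.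
(* Stacking [e] under [V] gives a square unitary matrix, so [V^* V + e^* e = 1]. *)
- have W : col_mx V e \is unitarymx.
    apply/unitarymxP; rewrite tr_col_mx map_row_mx mul_col_row VV ee Ve.
    have -> : e *m V^t* = 0.
      by rewrite -[LHS]trmxCK trmx_mul map_mxM trmxCK Ve trmx0 map_mx0.
    by rewrite -scalar_mx_block.
  have := mulmxKtV 1%:M W (addn1 n).
  rewrite mul1mx tr_col_mx map_row_mx mul_row_col e_ee => <-; rewrite addrK.
  by rewrite trmx_mul map_mxM mulmxA -(mulmxA _ _ P) PP' mulmx1.
- move: Ptrig; rewrite /similar_to conjymx; last exact/unitarymxP.
  by rewrite trmx_mul map_mxM !mulmxA.
Qed.

(** [t] is the diagonal of a single triangular compression, hence the same for all [k] and [alpha];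
    the weights depend on [k] but not on [alpha]. *)
Lemma exists_transition_sqminor (C : numClosedFieldType) (n : nat)
    (d : 'I_n.+1 -> C) : (0 < n)%N ->
  exists t : 'I_n -> C, forall k,
  exists Q : {set 'I_n} -> {set 'I_n.+1} -> C,
  [/\ forall S K, 0 <= Q S K,
      forall S : {set 'I_n}, #|S| = k ->
        \sum_(K : {set 'I_n.+1} | #|K| == k) Q S K = 1,
      forall K : {set 'I_n.+1}, #|K| = k ->
        \sum_(S : {set 'I_n} | #|S| == k) Q S K = 1 - k%:R / n.+1%:R &
      forall (alpha : C) (S : {set 'I_n}), #|S| = k ->
        \prod_(j in S) (t j - alpha) =
        \sum_(K : {set 'I_n.+1} | #|K| == k)
          Q S K * \prod_(i in K) (d i - alpha)].
Proof.
move=> n_gt0.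
pose D : 'rV[C]_n.+1 := \row_i d i.
have [U [UU UU' Utrig]] := exists_unitary_trig_compression D n_gt0.
pose T := U *m diag_mx D *m U^t*.
exists (fun j => T j j) => k; exists (fun S K => sqminor U k S K); split.
- by move=> S K; exact: sqminor_ge0.
(* Row sums: taking all diagonal entries equal to 1 turns the compression into the identity and
   every product into 1. *)
- move=> S Sk; have := @sum_sqminor_prod _ _ _ U k (const_mx 1) S.
  rewrite diag_const_mx mulmx1 UU => /(_ (scalar_mx_is_trig _ _) Sk).
  rewrite [RHS]big1 => [<-|i _]; last by rewrite mxE eqxx.
  apply: eq_bigr => K _.
  by rewrite [X in _ * X]big1 ?mulr1 // => i _; rewrite mxE.
- move=> K Kk; apply: sum_sqminor_col => // f /andP[/injectiveP f_inj _].
  rewrite UU'.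
  (* Injectivity of [f] keeps the identity part, so the minor is that of the identity minus a
     rank-one matrix, with value [1 - k / n.+1]. *)
  have -> : mxsub f f (1%:M - n.+1%:R^-1 *: const_mx 1) =
     1%:M - (const_mx 1 : 'cV[C]_k) *m (n.+1%:R^-1 *: const_mx 1 : 'rV[C]_k).
    apply/matrixP => i j; rewrite !mxE big_ord1 !mxE (inj_eq f_inj) mul1r //.
  rewrite det_1Bmulmx det_mx11 !mxE.
  under eq_bigr do rewrite !mxE !mulr1.
  by rewrite sumr_const card_ord mulr_natl.
- move=> alpha S Sk.
  (* Since [U U^* = 1], the compression commutes with subtracting the scalar [alpha]. *)
  have E : U *m diag_mx (D - const_mx alpha) *m U^t* = T - alpha%:M.
    rewrite linearB /= diag_const_mx mulmxBr mulmxBl mul_mx_scalar.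
    by rewrite -scalemxAl UU scalemx1.
  have := @sum_sqminor_prod _ _ _ U k (D - const_mx alpha) S.
  rewrite E => /(_ _ Sk) H.
  rewrite -[RHS](_ : \prod_(j in S) (T - alpha%:M) j j = _).
    by apply: eq_bigr => j _; rewrite !mxE eqxx.
  rewrite -H; last first.
    apply/is_trig_mxP => i j ij; rewrite mxE (is_trig_mxP Utrig) // !mxE.
    by rewrite -val_eqE ltn_eqF // mulr0n subr0.
  apply: eq_bigr => K _; congr (_ * _); by apply: eq_bigr => i _; rewrite !mxE.
Qed.

End Compression.

(** * Jensen's inequality *)

Lemma convex_functionE (R : realType) (E : lmodType R)
    (f : convex_lmodType E -> R^o) : convex_function [set: E]%classic f ->
  forall (t : R) (x y : E), 0 <= t -> t <= 1 ->
  f (t *: x + (1 - t) *: y) <= t * f x + (1 - t) * f y.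
Proof.
move=> cf t x y t0 t1; have := cf (Itv01 t0 t1) x y; apply; exact/mem_set.
Qed.

(** Weights are normalised by their sum because the tail of a list of weights summing to 1 no longer
    sums to 1; this form passes through the induction. *)
Lemma jensen_weighted (R : realType) (E : lmodType R)
    (f : convex_lmodType E -> R^o) (I : eqType) (r : seq I)
    (w : I -> R) (x : I -> E) :
  convex_function [set: E]%classic f -> (forall i, 0 <= w i) ->
  0 < \sum_(i <- r) w i ->
  f ((\sum_(i <- r) w i)^-1 *: \sum_(i <- r) w i *: x i) <=
  (\sum_(i <- r) w i)^-1 * \sum_(i <- r) w i * f (x i).
Proof.
move=> /convex_functionE cf w0; elim: r => [|i r IH].
  by rewrite big_nil ltxx.
rewrite !big_cons; set W := \sum_(j <- r) w j; set S := \sum_(j <- r) _.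
set F := \sum_(j <- r) _ * _ => W0.
have : 0 <= W by apply: sumr_ge0 => j _; exact: w0.
rewrite le_eqVlt => /orP[/eqP W_eq0|W_gt0].
  have wr j : j \in r -> w j = 0.
    have : all (fun j => true ==> (w j == 0)) r.
      by rewrite -psumr_eq0 // -/W -W_eq0.
    by move=> /allP H /H /eqP.
  have -> : S = 0.
    by rewrite /S big1_seq // => j /andP[_ /wr ->]; rewrite scale0r.
  have -> : F = 0.
    by rewrite /F big1_seq // => j /andP[_ /wr ->]; rewrite mul0r.
  move: W0; rewrite -W_eq0 !addr0 => wi0.
  by rewrite scalerA mulrA mulVf ?gt_eqF // scale1r mul1r.
have {IH} := IH W_gt0; rewrite -/S -/F -/W => IH.
have wW : w i + W != 0 by rewrite gt_eqF.
have W_neq0 : W != 0 by rewrite gt_eqF.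
have tE : 1 - w i / (w i + W) = W / (w i + W) by field.
have t0 : 0 <= w i / (w i + W) by rewrite divr_ge0 ?w0 // ltW.
have t1 : w i / (w i + W) <= 1.
  by rewrite ler_pdivrMr // mul1r lerDl ltW.
(* Convexity is applied between the head and the weighted mean of the tail. *)
have := cf _ (x i) (W^-1 *: S) t0 t1; rewrite tE.
rewrite scalerA mulrAC divff // mul1r.
rewrite -(mulrC _^-1) -scalerA -scalerDr => /le_trans; apply.
rewrite mulrDr mulrA lerD2l.
have -> : (w i + W)^-1 * F = W / (w i + W) * (W^-1 * F).
  by field; rewrite W_neq0 wW.
by rewrite ler_wpM2l // divr_ge0 ?ltW.
Qed.

Lemma jensen (R : realType) (E : lmodType R)
    (f : convex_lmodType E -> R^o) (I : finType) (w : I -> R) (x : I -> E) :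
  convex_function [set: E]%classic f -> (forall i, 0 <= w i) ->
  \sum_i w i = 1 -> f (\sum_i w i *: x i) <= \sum_i w i * f (x i).
Proof.
move=> cf w0 w1; have := @jensen_weighted _ _ f I (index_enum I) w x cf w0.
by rewrite w1 invr1 scale1r mul1r; apply; exact: ltr01.
Qed.

(** * Complex tuples as real vectors, majorization and means *)

(** The codomain is [Rcomplex R] so that the map can be declared linear over [R]. *)
Definition complex_of_rv (R : realType) (v : 'rV[R]_2) : Rcomplex R :=
  Complex (v 0 0) (v 0 1).

Lemma rv_of_complexK (R : realType) :
  cancel (@rv_of_complex R) (@complex_of_rv R).
Proof. by case=> a b; rewrite /complex_of_rv !mxE. Qed.

Lemma complex_of_rv_is_linear (R : realType) : linear (@complex_of_rv R).
Proof. by move=> a u v; rewrite /complex_of_rv !mxE. Qed.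

HB.instance Definition _ (R : realType) :=
  GRing.isLinear.Build R 'rV[R]_2 (Rcomplex R) _ (@complex_of_rv R)
    (@complex_of_rv_is_linear R).

Lemma rv_of_complex_sum (R : realType) (I : Type) (r : seq I) (a : I -> R)
    (y : I -> R[i]) :
  rv_of_complex (\sum_(j <- r) (a j)%:C%C * y j) =
  \sum_(j <- r) a j *: rv_of_complex (y j).
Proof.
elim/big_rec2: _ => [|j u v _ <-]; apply/rowP => l; rewrite !mxE ?if_same //.
by case: (y j) v => b c [b' c'] /=; case: ifP => _; rewrite mul0r ?subr0 ?addr0.
Qed.

Lemma sum_nth_ord (R : nmodType) (T : Type) (x0 : T) (s : seq T) (F : T -> R) :
  \sum_(i < size s) F (nth x0 s i) = \sum_(x <- s) F x.
Proof. by rewrite (big_nth x0) big_mkord. Qed.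

(** Jensen is applied to each row of the stochastic matrix, and the results are summed. *)
Lemma cmajorized_convex (R : realType) (X Y : seq R[i]) (f : R[i] -> R) :
  cconvex f -> (0 < size X)%N -> cmajorized X Y ->
  (size X)%:R^-1 * \sum_(x <- X) f x <= (size Y)%:R^-1 * \sum_(y <- Y) f y.
Proof.
move=> cf X_gt0 [s [t [sX tY [P [[_ P0 P1 Pc] sE]]]]].
have szs : size s = size X by rewrite (perm_size sX) size_map.
have szt : size t = size Y by rewrite (perm_size tY) size_map.
have sumE (Z : seq R[i]) u : perm_eq u (map (@rv_of_complex R) Z) ->
    \sum_(x <- Z) f x = \sum_(i < size u) f (complex_of_rv u`_i).
  move=> uZ; rewrite (sum_nth_ord 0 u (fun v => f (complex_of_rv v))).
  rewrite (perm_big _ uZ) big_map; apply: eq_bigr => z _.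
  by rewrite rv_of_complexK.
rewrite (sumE _ _ sX) (sumE _ _ tY).
have szX : (size X)%:R != 0 :> R by rewrite pnatr_eq0 -lt0n.
rewrite ler_pdivrMl ?ltr0n // mulrA mulr_sumr.
(* The factor [size X / size Y] is read as the [j]-th column sum of [P]. *)
under [X in _ <= X]eq_bigr => j _.
  rewrite -szs -szt -(Pc j) mulr_suml; over.
rewrite exchange_big /=; apply: ler_sum => i _.
have -> : s`_i = \sum_j P i j *: t`_j.
  have /(congr1 (row i)) := sE; rewrite rowK row_mul mulmx_sum_row => ->.
  by apply: eq_bigr => j _; rewrite rowK mxE.
rewrite linear_sum /=; under [X in f X]eq_bigr do rewrite linearZ.
exact: (@jensen R (Rcomplex R) f _ (P i) (fun j => complex_of_rv t`_j)).
Qed.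

Lemma cmajorized_perm (R : realType) (X X' Y Y' : seq R[i]) :
  perm_eq X X' -> perm_eq Y Y' -> cmajorized X Y -> cmajorized X' Y'.
Proof.
move=> XX' YY' [s [t [sX tY sP]]]; exists s, t; split => //.
  exact: perm_trans sX (perm_map _ XX').
exact: perm_trans tY (perm_map _ YY').
Qed.

Lemma sum_tnth_cast (R : nmodType) (T : Type) (N : nat) (s : seq T)
    (e : N = size s) (F : T -> R) :
  \sum_(i < N) F (tnth (in_tuple s) (cast_ord e i)) = \sum_(x <- s) F x.
Proof.
by subst N; rewrite [RHS]big_tnth; apply: eq_bigr => i _; rewrite cast_ord_id.
Qed.

(** The weights are attached to indices, since values may repeat, and are complex, as the squared
    minors are. *)
Lemma cmajorized_map (R : realType) (I J : eqType) (r : seq I) (s : seq J)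
    (x : I -> R[i]) (y : J -> R[i]) (Q : I -> J -> R[i]) :
  (size r <= size s)%N -> (forall i j, 0 <= Q i j) ->
  (forall i, i \in r -> \sum_(j <- s) Q i j = 1) ->
  (forall j, j \in s -> \sum_(i <- r) Q i j = (size r)%:R / (size s)%:R) ->
  (forall i, i \in r -> x i = \sum_(j <- s) Q i j * y j) ->
  cmajorized (map x r) (map y s).
Proof.
move=> le_rs Q0 Q1 Qc xE.
exists (map (@rv_of_complex R) (map x r)), (map (@rv_of_complex R) (map y s)).
split=> //.
have er : size (map (@rv_of_complex R) (map x r)) = size r by rewrite !size_map.
have es : size (map (@rv_of_complex R) (map y s)) = size s by rewrite !size_map.
pose ri i := tnth (in_tuple r) (cast_ord er i).
pose sj j := tnth (in_tuple s) (cast_ord es j).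
(* A nonnegative complex number is real, so taking real parts loses nothing. *)
have QE i j : (complex.Re (Q i j))%:C%C = Q i j by rewrite RRe_real ?ger0_real.
exists (\matrix_(i, j) complex.Re (Q (ri i) (sj j))); split.
  split.
  - by rewrite er es.
  - by move=> i j; rewrite mxE -ler0c QE.
  - move=> i; apply: complexI; rewrite rmorph_sum /=.
    under eq_bigr do rewrite mxE QE.
    by rewrite (sum_tnth_cast es (Q (ri i))) Q1 // mem_tnth.
  - move=> j; apply: complexI; rewrite rmorph_sum /=.
    under eq_bigr do rewrite mxE QE.
    rewrite (sum_tnth_cast er (fun i => Q i (sj j))) Qc ?mem_tnth //.
    by rewrite er es fmorph_div !rmorph_nat.
have nthE (T : Type) (u : seq T) (z : T -> R[i])
    (e : size (map (@rv_of_complex R) (map z u)) = size u)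
    (i : 'I_(size (map (@rv_of_complex R) (map z u)))) :
    (map (@rv_of_complex R) (map z u))`_i =
    rv_of_complex (z (tnth (in_tuple u) (cast_ord e i))).
  have iu : (i < size u)%N by rewrite -e.
  have key (t0 : T) (k : nat) : (k < size u)%N ->
      (map (@rv_of_complex R) (map z u))`_k = rv_of_complex (z (nth t0 u k)).
    by move=> ku; rewrite -map_comp (nth_map t0).
  (* The entry itself serves as the default value that [nth] needs in [T]. *)
  pose t0 := tnth (in_tuple u) (cast_ord e i).
  by rewrite (key t0) // [in RHS](tnth_nth t0).
apply/row_matrixP => i; rewrite rowK row_mul mulmx_sum_row nthE -/(ri i).
rewrite xE ?mem_tnth // -(sum_tnth_cast es (fun j => Q (ri i) j * y j)).
under eq_bigr do rewrite -QE.
rewrite rv_of_complex_sum; apply: eq_bigr => j _.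
by rewrite rowK nthE !mxE.
Qed.

Lemma size_shifted_products (R : realType) (n : nat) (z : 'I_n -> R[i])
    (alpha : R[i]) (k : nat) : size (shifted_products z alpha k) = 'C(n, k).
Proof. by rewrite size_image card_draws card_ord. Qed.

Lemma sum_shifted_products (R : realType) (n : nat) (z : 'I_n -> R[i])
    (alpha : R[i]) (k : nat) (f : R[i] -> R) :
  \sum_(x <- shifted_products z alpha k) f x =
  \sum_(A : {set 'I_n} | #|A| == k) f (\prod_(i in A) (z i - alpha)).
Proof. by rewrite big_image; apply: eq_bigl => A; rewrite inE. Qed.

Lemma cmajorized_mean_ineq (R : realType) (n : nat) (z : 'I_n -> R[i])
    (w : 'I_n.-1 -> R[i]) (f : R[i] -> R) (alpha : R[i]) (k : nat) :
  cconvex f -> (k <= n.-1)%N ->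
  cmajorized (shifted_products w alpha k) (shifted_products z alpha k) ->
  mean_ineq z w f alpha k.
Proof.
move=> cf kn /(cmajorized_convex cf); rewrite !size_shifted_products bin_gt0.
by move=> /(_ kn); rewrite !sum_shifted_products.
Qed.

(** * Elementary symmetric functions and the derivative *)

Lemma coef_prod_XsubC_ord (R : comNzRingType) (n : nat) (z : 'I_n -> R)
    (k : nat) :
  (k <= n)%N ->
  (\prod_(i < n) ('X - (z i)%:P))`_k =
  (-1) ^+ (n - k) *
    \sum_(A : {set 'I_n} | #|A| == (n - k)%N) \prod_(i in A) z i.
Proof.
move=> kn.
have H (s : seq R) m : size s = m -> (k <= m)%N ->
    (\prod_(x <- s) ('X - x%:P))`_k =
    (-1) ^+ (m - k) *
      \sum_(A : {set 'I_m} | #|A| == (m - k)%N) \prod_(i in A) s`_i.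
  by move=> <-; exact: coef_prod_XsubC.
have := H (codom z) n; rewrite size_codom card_ord => /(_ erefl kn).
rewrite big_image /= => ->; congr (_ * _); apply: eq_bigr => A _.
apply: eq_bigr => i _.
by rewrite /codom /image_mem (nth_map i) ?size_enum_ord // nth_ord_enum.
Qed.

(** Coefficients are compared: in degree [i] both sides involve the elementary symmetric functions
    of order [n - i], with the same sign. *)
Lemma deriv_prod_XsubC_of_elementary (F : numFieldType) (n : nat)
    (z : 'I_n.+1 -> F) (w : 'I_n -> F) :
  (forall k, (k <= n)%N ->
     'C(n, k)%:R^-1 * \sum_(A : {set 'I_n} | #|A| == k) \prod_(j in A) w j =
     'C(n.+1, k)%:R^-1 *
       \sum_(A : {set 'I_n.+1} | #|A| == k) \prod_(j in A) z j) ->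
  n.+1%:R *: \prod_(j < n) ('X - (w j)%:P) =
  (\prod_(i < n.+1) ('X - (z i)%:P))^`().
Proof.
move=> H; apply/polyP => i; rewrite coefZ coef_deriv.
have [le_in|lt_ni] := leqP i n; last first.
  rewrite !nth_default ?mulr0 ?mul0rn // size_prod_XsubC //;
  by rewrite /index_enum -enumT size_enum_ord.
rewrite !coef_prod_XsubC_ord // subSS mulrCA -mulrnAr; congr (_ * _).
have kn : (n - i <= n)%N by rewrite leq_subr.
have kn' : (n - i <= n.+1)%N by rewrite ltnW.
have c0 : 'C(n, n - i)%:R != 0 :> F by rewrite pnatr_eq0 -lt0n bin_gt0.
have c0' : 'C(n.+1, n - i)%:R != 0 :> F by rewrite pnatr_eq0 -lt0n bin_gt0.
have := H _ kn; move/(canRL (mulVKf c0)).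
set ew := \sum_(A | _) _; set ez := \sum_(A | _) _ => H1.
(* The identity [(n+1) C(n,k) = (n+1-k) C(n+1,k)] at [k = n - i]; the factor [i+1] is the one
   produced by differentiation. *)
have : n.+1%:R * 'C(n, n - i)%:R = i.+1%:R * 'C(n.+1, n - i)%:R :> F.
  by rewrite -!natrM (mul_bin_down n.+1) subSn // subKn.
by move=> E; rewrite H1 mulrA E -mulrA mulVKf // mulr_natl.
Qed.

Lemma linear_cconvex (R : realType) (f : R[i] -> R) :
  (forall (a b : R) (x y : R[i]),
     f (a%:C%C * x + b%:C%C * y) = a * f x + b * f y) -> cconvex f.
Proof.
move=> fE t x y _ _.
have -> : conv t x y = (t%:num)%:C%C * x + (1 - t%:num)%:C%C * y :> R[i].
  case: x y => x1 x2 [y1 y2]; apply/eqP.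
  by rewrite eq_complex /= !mul0r !subr0 !addr0 !eqxx.
by rewrite fE.
Qed.

(** A real-linear [f] and its opposite are both convex, so the two means have the same image under
    [f]; [Re] and [Im] then determine them. *)
Lemma mean_eq_of_mean_ineq (R : realType) (n : nat) (z : 'I_n -> R[i])
    (w : 'I_n.-1 -> R[i]) (alpha : R[i]) (k : nat) :
  (forall f : R[i] -> R, cconvex f -> mean_ineq z w f alpha k) ->
  'C(n.-1, k)%:R^-1 *
    \sum_(A : {set 'I_n.-1} | #|A| == k) \prod_(j in A) (w j - alpha) =
  'C(n, k)%:R^-1 *
    \sum_(A : {set 'I_n} | #|A| == k) \prod_(j in A) (z j - alpha).
Proof.
move=> H.
have eq_of (f : R[i] -> R) : (forall (a b : R) (x y : R[i]),
     f (a%:C%C * x + b%:C%C * y) = a * f x + b * f y) ->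
  f ('C(n.-1, k)%:R^-1 *
    \sum_(A : {set 'I_n.-1} | #|A| == k) \prod_(j in A) (w j - alpha)) =
  f ('C(n, k)%:R^-1 *
    \sum_(A : {set 'I_n} | #|A| == k) \prod_(j in A) (z j - alpha)).
  move=> fE.
  have f0 : f 0 = 0 by have := fE 0 0 0 0; rewrite !(mulr0, mul0r, addr0).
  have fD x y : f (x + y) = f x + f y.
    by have := fE 1 1 x y; rewrite !(rmorph1, mul1r).
  have fM m x : f (m%:R^-1 * x) = m%:R^-1 * f x.
    have := fE m%:R^-1 0 x 0.
    by rewrite !(mulr0, mul0r, addr0) fmorphV rmorph_nat.
  rewrite !fM !(big_morph f fD f0); apply/eqP; rewrite eq_le; apply/andP; split.
    exact: H (linear_cconvex fE).
  have : cconvex (fun x => - f x).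
    by apply: linear_cconvex => a b x y; rewrite fE opprD !mulrN.
  by move=> /H; rewrite /mean_ineq !sumrN !mulrN lerN2.
apply/eqP; rewrite eq_complex.
rewrite (eq_of (@complex.Re R)) ?(eq_of (@complex.Im R)) ?eqxx //;
by move=> a b [x1 x2] [y1 y2] /=; rewrite !mul0r ?subr0 ?addr0.
Qed.

Lemma mean_ineq_deriv (R : realType) (n : nat) (z : 'I_n.+1 -> R[i])
    (w : 'I_n -> R[i]) :
  (forall f : R[i] -> R, cconvex f ->
     forall k, (1 <= k <= n)%N -> mean_ineq (n := n.+1) z w f 0 k) ->
  n.+1%:R *: \prod_(j < n) ('X - (w j)%:P) =
  (\prod_(i < n.+1) ('X - (z i)%:P))^`().
Proof.
(* Order 0, outside the range of the hypothesis, compares leading coefficients: both means are 1. *)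
move=> H; apply: deriv_prod_XsubC_of_elementary => -[_|k kn].
  rewrite !bin0; congr (_ * _).
  have E (m : nat) (x : 'I_m -> R[i]) :
      \sum_(A : {set 'I_m} | #|A| == 0) \prod_(j in A) x j = 1.
    by rewrite (big_pred1 finset.set0) ?big_set0 // => A; rewrite cards_eq0.
  by rewrite !E.
have := @mean_eq_of_mean_ineq R n.+1 z w 0 k.+1 (fun f cf => H f cf k.+1 kn).
have E (m : nat) (x : 'I_m -> R[i]) :
    \sum_(A : {set 'I_m} | #|A| == k.+1) \prod_(j in A) (x j - 0) =
    \sum_(A : {set 'I_m} | #|A| == k.+1) \prod_(j in A) x j.
  by apply: eq_bigr => A _; apply: eq_bigr => j _; rewrite subr0.
by rewrite !E.
Qed.

(** * Majorization from the derivative identity, and the equivalence *)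

(** In characteristic 0 the integers below [size (p - q)] are distinct roots of [p - q], too many
    for a nonzero polynomial. *)
Lemma eq_poly_horner (F : numFieldType) (p q : {poly F}) :
  (forall x, p.[x] = q.[x]) -> p = q.
Proof.
move=> pq; apply/eqP; rewrite -subr_eq0; apply/eqP.
pose s := [seq i%:R : F | i <- iota 0 (size (p - q))].
apply: (@roots_geq_poly_eq0 _ _ s).
- by apply/allP => x _; rewrite /root hornerD hornerN pq subrr.
- by rewrite map_inj_uniq ?iota_uniq // => i j /eqP; rewrite eqr_nat => /eqP.
- by rewrite size_map size_iota.
Qed.

(** Taking images under [s] permutes the [k]-subsets. *)
Lemma shifted_products_perm (R : realType) (n : nat) (z : 'I_n -> R[i])
    (s : 'S_n) (alpha : R[i]) (k : nat) :
  perm_eq (shifted_products z alpha k) (shifted_products (z \o s) alpha k).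
Proof.
pose I := [set B : {set 'I_n} | #|B| == k].
have -> : shifted_products (z \o s) alpha k =
   map (fun A : {set 'I_n} => \prod_(i in A) (z i - alpha))
     [seq s @: A | A : {set 'I_n} in I].
  rewrite -map_comp; apply: eq_map => A /=.
  by rewrite big_imset //= => i j _ _ /perm_inj.
apply: perm_map; apply: uniq_perm; rewrite ?enum_uniq //.
  by rewrite map_inj_uniq ?enum_uniq //; exact: imset_inj perm_inj.
move=> A; rewrite mem_enum inE; apply/idP/fintype.imageP => [Ak|[B]].
  exists ((s^-1)%g @: A).
    by rewrite inE card_imset //; exact: perm_inj.
  rewrite -imset_comp -[LHS]imset_id; apply: eq_imset => i.
  by rewrite /= permKV.
by rewrite inE => Bk ->; rewrite card_imset //; exact: perm_inj.
Qed.

Lemma exists_cmajorized_shifted_products (R : realType) (n : nat)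
    (z : 'I_n.+1 -> R[i]) : (0 < n)%N ->
  exists t : 'I_n -> R[i], forall (alpha : R[i]) (k : nat), (k <= n)%N ->
    cmajorized (shifted_products t alpha k) (shifted_products z alpha k).
Proof.
move=> n_gt0; have [t tP] := exists_transition_sqminor z n_gt0.
exists t => alpha k kn; have [Q [Q0 Q1 Qc QE]] := tP k.
have sumE m (F : {set 'I_m} -> R[i]) :
    \sum_(A <- enum [set B : {set 'I_m} | #|B| == k]) F A =
    \sum_(A : {set 'I_m} | #|A| == k) F A.
  by rewrite big_enum; apply: eq_bigl => A; rewrite inE.
have sizeE m : size (enum [set B : {set 'I_m} | #|B| == k]) = 'C(m, k).
  by rewrite -cardE card_draws card_ord.
apply: (@cmajorized_map _ _ _ _ _ _ _ Q) => //.
- by rewrite !sizeE; apply: leq_bin2l.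
- by move=> S; rewrite mem_enum inE sumE => /eqP; exact: Q1.
(* The column sum [1 - k/(n+1)] equals [C(n,k) / C(n+1,k)], the ratio of the tuple sizes. *)
- move=> K; rewrite mem_enum inE sumE !sizeE => /eqP /Qc ->.
  have c0 : 'C(n.+1, k)%:R != 0 :> R[i] by rewrite pnatr_eq0 -lt0n bin_gt0 ltnW.
  have n0 : n.+1%:R != 0 :> R[i] by rewrite pnatr_eq0.
  apply: (mulfI n0); apply: (mulIf c0).
  rewrite mulrBr mulr1 mulrCA mulfV // mulr1 -natrB ?(leqW kn) //.
  by rewrite mulrA divfK // -!natrM -(mul_bin_down n.+1).
- by move=> S; rewrite mem_enum inE sumE => /eqP; exact: QE.
Qed.

Lemma cmajorized_of_deriv (R : realType) (n : nat) (z : 'I_n.+1 -> R[i])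
    (w : 'I_n -> R[i]) (alpha : R[i]) (k : nat) :
  n.+1%:R *: \prod_(j < n) ('X - (w j)%:P) =
    (\prod_(i < n.+1) ('X - (z i)%:P))^`() ->
  (0 < n)%N -> (k <= n)%N ->
  cmajorized (shifted_products w alpha k) (shifted_products z alpha k).
Proof.
move=> wE n_gt0 kn; have [t tP] := exists_cmajorized_shifted_products z n_gt0.
have tE : n.+1%:R *: \prod_(j < n) ('X - (t j)%:P) =
    (\prod_(i < n.+1) ('X - (z i)%:P))^`().
  apply: mean_ineq_deriv => f cf l /andP[_ ln].
  exact: (@cmajorized_mean_ineq R n.+1 z t f 0 l cf ln (tP 0 l ln)).
(* Both families factor the same polynomial into linear terms, so they agree up to order. *)
have : perm_eq [tuple w i | i < n] [tuple t i | i < n].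
  apply: prod_XsubC_eq; rewrite !big_map -!enumT !big_enum.
  by apply: (@scalerI _ _ n.+1%:R); rewrite ?pnatr_eq0 // wE tE.
move=> /tuple_permP[s ws].
have {ws} ws i : w i = t (s i).
  have /(congr1 (fun u => nth 0 u i)) := ws.
  by rewrite -!tnth_nth !tnth_mktuple.
apply: cmajorized_perm (tP alpha k kn) => //.
apply: perm_trans (shifted_products_perm t s alpha k) _.
have -> : shifted_products w alpha k = shifted_products (t \o s) alpha k => //.
by apply: eq_map => A; apply: eq_bigr => i _; rewrite ws.
Qed.

Theorem theorem3p3 (R : realType) (n : nat) (hn : (2 <= n)%N)
    (z : 'I_n -> R[i]) (w : 'I_n.-1 -> R[i]) :
  let p : {poly R[i]} := \prod_(i < n) ('X - (z i)%:P) in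
  let q : {poly R[i]} := n%:R *: \prod_(j < n.-1) ('X - (w j)%:P) in
  [<-> (forall x : R[i], q.[x] = p^`().[x]);
       (forall (alpha : R[i]) (k : nat), (1 <= k <= n.-1)%N ->
          cmajorized (shifted_products w alpha k) (shifted_products z alpha k));
       (forall k : nat, (1 <= k <= n.-1)%N ->
          cmajorized (shifted_products w 0 k) (shifted_products z 0 k));
       (forall f : R[i] -> R, cconvex f ->
          forall (alpha : R[i]) (k : nat), (1 <= k <= n.-1)%N ->
          mean_ineq z w f alpha k);
       (forall f : R[i] -> R, cconvex f ->
          forall k : nat, (1 <= k <= n.-1)%N ->
          mean_ineq z w f 0 k)].
Proof.
case: n hn z w => [//|n] n_gt0 z w p q.
tfae.
- move=> qE alpha k /andP[_ kn]; apply: cmajorized_of_deriv => //.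
  exact: eq_poly_horner.
- by move=> maj k; exact: maj.
(* Majorization is known only at 0. It yields the derivative identity, which gives back majorization
   at every [alpha]. *)
- move=> maj f cf alpha k /andP[_ kn].
  apply: (@cmajorized_mean_ineq R n.+1) => //; apply: cmajorized_of_deriv => //.
  apply: mean_ineq_deriv => g cg l /[dup] lP /andP[_ ln].
  exact: (@cmajorized_mean_ineq R n.+1 z w g 0 l cg ln (maj l lP)).
- by move=> mean f cf; exact: mean.
- by move=> mean x; rewrite /q (@mean_ineq_deriv R n z w mean).
Qed.
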